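(* Let $R$ be a (commutative, unital) finite dimensional algebra over a field $k$, and let $I$ be an ideal of $R$ such that $R$ is an $I$-reduced $R$-module and $R/I$ is a projective $R$-module. For the functors $$\Gamma_I : R\text{-proj}\rightarrow \mathbf{Set}\quad\text{and}\quad \mathcal{V} : R\text{-proj}\rightarrow R\text{-inj},$$ we have (with $M$ ranging over $R\text{-proj}$) $$\mathrm{Nat}(\Gamma_I(M), \mathcal{V}(M))\cong \mathcal{D}(0:_R I).$$
   Context: $R\text{-mod}$ is the category of finitely generated $R$-modules; $R\text{-proj}$ and $R\text{-inj}$ are its full subcategories of projective, respectively injective, $R$-modules. $\Gamma_I(M):=\varinjlim_k \mathrm{Hom}_R(R/I^k, M)$ is the $I$-torsion functor. For an $R$-module $M$ and $a\in R$ let $f_a:M\to M$ be $m\mapsto am$ and $f_a^2=f_a\circ f_a$; $M$ is $I$-reduced if $\mathrm{Ker} f_a\cong \mathrm{Ker} f_a^2$ for every $a\in I$. $(0:_RI)=\{r\in R: Ir=0\}$. $\mathcal{D}:=\mathrm{Hom}_k(-,k)$, and the Nakayama functor is $\mathcal{V}:=\mathcal{D}\,\mathrm{Hom}_R(-,R)$, which restricts to an equivalence $R\text{-proj}\to R\text{-inj}$. $\mathrm{Nat}(\Gamma_I(M),\mathcal V(M))$ denotes the natural transformations between the functors $\Gamma_I(-)$ and $\mathcal V(-)$ on $R\text{-proj}$, regarded as $\mathbf{Set}$-valued. *)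

(* Defs.v *)
From HB Require Import structures.
From mathcomp Require Import all_boot all_algebra.
From mathcomp Require Import boolp.

Set Implicit Arguments.
Unset Strict Implicit.
Unset Printing Implicit Defensive.

Import GRing.Theory.

Local Open Scope ring_scope.
Local Open Scope quotient_scope.

Record submodule (R : pzRingType) (V : lmodType R) := Submodule {
  submodule_pred :> {pred V};
  submoduleP : submod_closed submodule_pred
}.

Section SubmoduleClosed.
Variables (R : pzRingType) (V : lmodType R) (S : submodule V).

Fact submodule_zmod_closed : zmod_closed S.
Proof. exact/GRing.submod_closedB/submoduleP. Qed.

Fact submodule_scaler_closed : GRing.scaler_closed S.
Proof. exact/GRing.subsemimod_closedZ/GRing.submod_closed_semi/submoduleP. Qed.

HB.instance Definition _ :=
  GRing.isZmodClosed.Build V (submodule_pred S) submodule_zmod_closed.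
HB.instance Definition _ :=
  GRing.isScaleClosed.Build R V (submodule_pred S) submodule_scaler_closed.
End SubmoduleClosed.

(* The unit ideal is allowed, and with the excluded middle of [boolp] boolean
   membership is no restriction. *)
Notation ideal R := (submodule R^o).

Section Submodules.
Variables (R : pzRingType) (V : lmodType R) (S : submodule V).

Definition submod : Type := {x : V | x \in S}.
HB.instance Definition _ := SubChoice.on submod.
HB.instance Definition _ := [SubChoice_isSubZmodule of submod by <:].
HB.instance Definition _ := [SubZmodule_isSubLmodule of submod by <:].

Definition quotmod : Type := Quotient.quot S.
HB.instance Definition _ := ZmodQuotient.on quotmod.

Let scaleq (a : R) (x : quotmod) : quotmod := \pi_quotmod (a *: repr x).

Let pi_scaleq a (x : V) : scaleq a (\pi_quotmod x) = \pi_quotmod (a *: x).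
Proof.
apply/eqP; rewrite -Quotient.idealrBE -scalerBr rpredZ //.
by rewrite Quotient.idealrBE reprK.
Qed.

Lemma quotmod_ind (P : quotmod -> Prop) :
  (forall x, P (\pi_quotmod x)) -> forall x, P x.
Proof. by move=> h x; rewrite -[x]reprK. Qed.

Let scaleqA a b x : scaleq a (scaleq b x) = scaleq (a * b) x.
Proof. by elim/quotmod_ind: x => x; rewrite !pi_scaleq scalerA. Qed.

Let scale1q : left_id 1 scaleq.
Proof. by elim/quotmod_ind => x; rewrite pi_scaleq scale1r. Qed.

Let scaleqDr : right_distributive scaleq +%R.
Proof.
move=> a; elim/quotmod_ind => x; elim/quotmod_ind => y.
by rewrite -raddfD !pi_scaleq scalerDr raddfD.
Qed.

Let scaleqDl x : {morph scaleq^~ x : a b / a + b}.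
Proof.
by move=> a b; elim/quotmod_ind: x => x; rewrite !pi_scaleq scalerDl raddfD.
Qed.

HB.instance Definition _ :=
  GRing.Zmodule_isLmodule.Build R quotmod scaleqA scale1q scaleqDr scaleqDl.

Lemma pi_quotmodZ a (x : V) : a *: \pi_quotmod x = \pi_quotmod (a *: x).
Proof. exact: pi_scaleq. Qed.

End Submodules.

Section LinearMaps.
Variables (R : pzRingType) (U V W : lmodType R).

Definition linear_map (f : U -> V) (fP : linear f) : {linear U -> V} :=
  HB.pack f (GRing.isLinear.Build R U V *:%R f fP).

Lemma linear_eqP (f g : {linear U -> V}) : f =1 g -> f = g.
Proof.
case: f g => [f [[Mf] [Sf]]] [g [[Mg] [Sg]]] /= /funext efg.
move: Mf Sf Mg Sg; rewrite efg => Mf Sf Mg Sg.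
by rewrite (Prop_irrelevance Mf Mg) (Prop_irrelevance Sf Sg).
Qed.
End LinearMaps.

Definition linear_comp (R : pzRingType) (U V W : lmodType R)
  (g : {linear V -> W}) (f : {linear U -> V}) : {linear U -> W} := g \o f.

Definition linear_id (R : pzRingType) (U : lmodType R) : {linear U -> U} :=
  @idfun U.

Section Kernel.
Variables (R : pzRingType) (U V : lmodType R) (f : {linear U -> V}).

Fact ker_submod_closed : submod_closed [pred x | f x == 0].
Proof.
split=> [|a u v]; rewrite !inE ?linear0 // => /eqP fu /eqP fv.
by rewrite linearP fu fv scaler0 addr0.
Qed.

Definition ker : submodule U := Submodule ker_submod_closed.
End Kernel.

Section QuotientProjection.
Variables (R : pzRingType) (V : lmodType R) (S T : submodule V).
Hypothesis leST : {subset S <= T}.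

Let proj (x : quotmod S) : quotmod T := \pi_(quotmod T) (repr x).

Let projE x : proj (\pi_(quotmod S) x) = \pi_(quotmod T) x.
Proof.
apply/eqP; rewrite -Quotient.idealrBE; apply: leST.
by rewrite Quotient.idealrBE reprK.
Qed.

Fact quotmod_proj_linear : linear proj.
Proof.
move=> a; elim/quotmod_ind => x; elim/quotmod_ind => y.
by rewrite pi_quotmodZ -raddfD !projE pi_quotmodZ -raddfD.
Qed.

Definition quotmod_proj : {linear quotmod S -> quotmod T} :=
  linear_map quotmod_proj_linear.

Lemma quotmod_projE x :
  quotmod_proj (\pi_(quotmod S) x) = \pi_(quotmod T) x.
Proof. exact: projE. Qed.
End QuotientProjection.

Section Modules.
Variables (R : pzRingType) (M : lmodType R).

Definition finitely_generated : Prop :=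
  exists (n : nat) (e : 'I_n -> M),
    forall x, exists c : 'I_n -> R, x = \sum_i c i *: e i.

Definition projective : Prop :=
  forall (A B : lmodType R) (p : {linear A -> B}) (f : {linear M -> B}),
    (forall b, exists a, p a = b) -> exists g : {linear M -> A}, p \o g =1 f.
End Modules.

Section Hom.
Variable R : comPzRingType.

Section HomModule.
Variables M N : lmodType R.

Definition Hom : Type := {linear M -> N}.
HB.instance Definition _ := gen_eqMixin Hom.
HB.instance Definition _ := gen_choiceMixin Hom.

Fact hom0_linear : linear (fun _ : M => 0 : N).
Proof. by move=> a x y; rewrite scaler0 addr0. Qed.

Fact homD_linear (f g : Hom) : linear (fun x => f x + g x).
Proof. by move=> a x y; rewrite !linearP scalerDr addrACA. Qed.

Fact homN_linear (f : Hom) : linear (fun x => - f x).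
Proof. by move=> a x y; rewrite linearP opprD scalerN. Qed.

Fact homZ_linear c (f : Hom) : linear (fun x => c *: f x).
Proof. by move=> a x y; rewrite linearP scalerDr !scalerA mulrC. Qed.

Let homD (f g : Hom) : Hom := linear_map (homD_linear f g).
Let homN (f : Hom) : Hom := linear_map (homN_linear f).
Let homZ c (f : Hom) : Hom := linear_map (homZ_linear c f).

Let homA : associative homD.
Proof. by move=> f g h; apply: linear_eqP => x /=; rewrite addrA. Qed.
Let homC : commutative homD.
Proof. by move=> f g; apply: linear_eqP => x /=; rewrite addrC. Qed.
Let hom0D : left_id (linear_map hom0_linear : Hom) homD.
Proof. by move=> f; apply: linear_eqP => x /=; rewrite add0r. Qed.
Let homND : left_inverse (linear_map hom0_linear : Hom) homN homD.
Proof. by move=> f; apply: linear_eqP => x /=; rewrite addNr. Qed.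
HB.instance Definition _ := GRing.isZmodule.Build Hom homA homC hom0D homND.

Let homZA a b f : homZ a (homZ b f) = homZ (a * b) f.
Proof. by apply: linear_eqP => x /=; rewrite scalerA. Qed.
Let homZ1 : left_id 1 homZ.
Proof. by move=> f; apply: linear_eqP => x /=; rewrite scale1r. Qed.
Let homZDr : right_distributive homZ +%R.
Proof. by move=> a f g; apply: linear_eqP => x /=; rewrite scalerDr. Qed.
Let homZDl f : {morph homZ^~ f : a b / a + b}.
Proof. by move=> a b; apply: linear_eqP => x /=; rewrite scalerDl. Qed.
HB.instance Definition _ :=
  GRing.Zmodule_isLmodule.Build R Hom homZA homZ1 homZDr homZDl.

Lemma homDE (f g : Hom) x : (f + g) x = f x + g x. Proof. by []. Qed.
Lemma homZE a (f : Hom) x : (a *: f) x = a *: f x. Proof. by []. Qed.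
End HomModule.

Section Precomposition.
Variables (L M N : lmodType R) (f : {linear L -> M}).

Fact hom_pre_linear : linear (fun g : Hom M N => linear_comp g f : Hom L N).
Proof. by move=> a g h; apply: linear_eqP. Qed.

Definition hom_pre : {linear Hom M N -> Hom L N} := linear_map hom_pre_linear.
End Precomposition.
End Hom.

Section Ideals.
Variable R : comNzRingType.

Fact unit_ideal_closed : submod_closed (predT : {pred R^o}).
Proof. by []. Qed.

Definition unit_ideal : ideal R := Submodule unit_ideal_closed.

Section Product.
Variables I J : ideal R.

Definition in_ideal_mul : {pred R^o} := fun x => `[< exists s : seq (R * R),
  {in s, forall p, p.1 \in I /\ p.2 \in J} /\ x = \sum_(p <- s) p.1 * p.2 >].

Fact ideal_mul_closed : submod_closed in_ideal_mul.
Proof.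
split=> [|a u v]; first by apply/asboolP; exists [::]; rewrite big_nil.
move=> /asboolP[s [sP ->]] /asboolP[t [tP ->]]; apply/asboolP.
exists ([seq (a * p.1, p.2) | p <- s] ++ t); split=> [p|].
  rewrite mem_cat => /orP[/mapP[q /sP[qI qJ] ->]|/tP//].
  by split=> //=; apply: (@submodule_scaler_closed _ _ I a q.1).
rewrite big_cat big_map /=; congr (_ + _).
by rewrite scaler_sumr; apply: eq_bigr => p _; rewrite -mulrA.
Qed.

Definition ideal_mul : ideal R := Submodule ideal_mul_closed.

Lemma ideal_mul_sub : {subset ideal_mul <= J}.
Proof.
move=> x /asboolP[s [sP ->]]; rewrite big_seq; apply: rpred_sum => p /sP[_ pJ].
exact: (@submodule_scaler_closed _ _ J p.1 p.2).
Qed.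
End Product.

Definition ideal_pow (I : ideal R) (n : nat) : ideal R :=
  iter n (ideal_mul I) unit_ideal.

Lemma ideal_pow_sub (I : ideal R) m n :
  (m <= n)%N -> {subset ideal_pow I n <= ideal_pow I m}.
Proof.
move=> /subnK <-; elim: (n - m)%N => // d IHd x.
by move=> /ideal_mul_sub; apply: IHd.
Qed.

Definition in_annihilator (I : ideal R) : {pred R^o} :=
  fun r => `[< forall a, a \in I -> a * r = 0 >].

Fact annihilator_closed (I : ideal R) : submod_closed (in_annihilator I).
Proof.
split=> [|c u v]; first by apply/asboolP => a _; rewrite mulr0.
move=> /asboolP uP /asboolP vP; apply/asboolP => a aI.
by rewrite mulrDr vP // addr0 mulrCA uP // mulr0.
Qed.

Definition annihilator (I : ideal R) : ideal R :=
  Submodule (annihilator_closed I).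

Fact mulmap_linear (M : lmodType R) (a : R) : linear (fun m : M => a *: m).
Proof. by move=> c x y; rewrite scalerDr !scalerA mulrC. Qed.

Definition mulmap (M : lmodType R) (a : R) : {linear M -> M} :=
  linear_map (mulmap_linear a).

Definition reduced (I : ideal R) (M : lmodType R) : Prop :=
  forall a, a \in I ->
    exists phi : {linear submod (ker (mulmap M a)) ->
                         submod (ker (linear_comp (mulmap M a) (mulmap M a)))},
      bijective phi.
End Ideals.

Record directedSystem := DirectedSystem {
  system_obj :> nat -> choiceType;
  system_map : forall i j, (i <= j)%N -> system_obj i -> system_obj j;
  system_map_id : forall i (h : (i <= i)%N) x, system_map h x = x;
  system_map_comp : forall i j l (hij : (i <= j)%N) (hjl : (j <= l)%N)
    (hil : (i <= l)%N) x, system_map hjl (system_map hij x) = system_map hil x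
}.

Section DirectLimit.
Variable S : directedSystem.

Definition limit_rel (x y : {i : nat & S i}) : bool :=
  `[< exists n (hx : (tag x <= n)%N) (hy : (tag y <= n)%N),
        system_map hx (tagged x) = system_map hy (tagged y) >].

Fact limit_rel_equiv : equiv_class_of limit_rel.
Proof.
split=> [x|x y|y x z].
- by apply/asboolP; exists (tag x), (leqnn _), (leqnn _).
- by apply/asboolP/asboolP => -[n [hx [hy e]]]; exists n, hy, hx.
move=> /asboolP[m [hx [hy exy]]] /asboolP[n [hy' [hz eyz]]].
have hm : (m <= maxn m n)%N by rewrite leq_maxl.
have hn : (n <= maxn m n)%N by rewrite leq_maxr.
apply/asboolP.
exists (maxn m n), (leq_trans hx hm), (leq_trans hz hn).
rewrite -(system_map_comp hx hm) exy -(system_map_comp hz hn) -eyz.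
by rewrite !(system_map_comp _ _ (leq_trans hy hm)).
Qed.

Canonical limit_equiv := EquivRelPack limit_rel_equiv.
Canonical limit_encModRel := defaultEncModRel limit_rel.

Definition direct_limit : Type := {eq_quot limit_rel}.
HB.instance Definition _ := EqQuotient.on direct_limit.

Definition to_limit i (x : S i) : direct_limit :=
  \pi_direct_limit (Tagged (fun n => S n : Type) x).
End DirectLimit.

Section DirectLimitMap.
Variables (S T : directedSystem) (u : forall i, S i -> T i).
Hypothesis u_nat : forall i j (h : (i <= j)%N) x,
  u (system_map h x) = system_map h (u x).

Definition limit_map (x : direct_limit S) : direct_limit T :=
  to_limit (u (tagged (repr x))).

Lemma limit_mapE i (x : S i) : limit_map (to_limit x) = to_limit (u x).
Proof.
have /eqP := reprK (to_limit x); rewrite [X in _ == X -> _]/to_limit.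
rewrite /limit_map; move: (repr _) => y; rewrite eqmodE.
move=> /asboolP[n [hy [hx /= e]]]; apply/eqP; rewrite eqmodE; apply/asboolP.
by exists n, hy, hx; rewrite /= -!u_nat e.
Qed.
End DirectLimitMap.

Section Torsion.
Variables (R : comNzRingType) (I : ideal R).

Section Object.
Variable M : lmodType R.

Definition torsion_obj (n : nat) : choiceType :=
  Hom (quotmod (ideal_pow I n)) M.

Definition torsion_trans i j (h : (i <= j)%N) :
  torsion_obj i -> torsion_obj j :=
  hom_pre M (quotmod_proj (ideal_pow_sub (I := I) h)).

Fact torsion_trans_id i (h : (i <= i)%N) f : torsion_trans h f = f.
Proof.
apply: linear_eqP; elim/quotmod_ind => x.
by rewrite -[LHS]/(f (quotmod_proj _ _)) quotmod_projE.
Qed.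

Fact torsion_trans_comp i j l (hij : (i <= j)%N) (hjl : (j <= l)%N)
  (hil : (i <= l)%N) f :
  torsion_trans hjl (torsion_trans hij f) = torsion_trans hil f.
Proof.
apply: linear_eqP; elim/quotmod_ind => x.
rewrite -[LHS]/(f (quotmod_proj _ (quotmod_proj _ _))).
by rewrite -[RHS]/(f (quotmod_proj _ _)) !quotmod_projE.
Qed.

Definition torsion_system : directedSystem :=
  DirectedSystem torsion_trans_id torsion_trans_comp.

(* Only the underlying set of the limit is constructed: the functor is used with
   values in sets. *)
Definition torsion : Type := direct_limit torsion_system.
End Object.

Section Morphism.
Variables (M N : lmodType R) (f : {linear M -> N}).

Definition torsion_post n (g : torsion_system M n) : torsion_system N n :=
  linear_comp f g.

Lemma torsion_post_nat i j (h : (i <= j)%N) g :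
  torsion_post (system_map h g) = system_map h (torsion_post g).
Proof. exact: linear_eqP. Qed.

Definition torsion_map : torsion M -> torsion N := limit_map torsion_post.

Lemma torsion_mapE n (g : torsion_system M n) :
  torsion_map (to_limit g) = to_limit (torsion_post g).
Proof. by apply: limit_mapE => *; apply: torsion_post_nat. Qed.
End Morphism.

Lemma torsion_ind (M : lmodType R) (P : torsion M -> Prop) :
  (forall n (g : torsion_system M n), P (to_limit g)) -> forall x, P x.
Proof.
move=> h x; rewrite -[x]reprK; case: (repr x) => n g; exact: h.
Qed.

Lemma torsion_map_id M x : torsion_map (linear_id M) x = x.
Proof.
elim/torsion_ind: x => n g; rewrite torsion_mapE.
by have -> : torsion_post (linear_id M) g = g by apply: linear_eqP.
Qed.

Lemma torsion_map_comp (L M N : lmodType R)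
    (g : {linear M -> N}) (f : {linear L -> M}) x :
  torsion_map (linear_comp g f) x = torsion_map g (torsion_map f x).
Proof.
elim/torsion_ind: x => n h; rewrite !torsion_mapE.
suff -> : torsion_post (linear_comp g f) h =
          torsion_post g (torsion_post f h) by [].
exact: linear_eqP.
Qed.
End Torsion.

Section Duality.
Variables (k : fieldType) (R : comAlgType k).

(* Restriction of scalars along the structure map k -> R. *)
Definition restrict (M : lmodType R) : Type := M.

Section RestrictModule.
Variable M : lmodType R.
HB.instance Definition _ := GRing.Zmodule.on (restrict M).

Let scalek (c : k) (x : restrict M) : restrict M := (c%:A : R) *: (x : M).
Let scalekA a b x : scalek a (scalek b x) = scalek (a * b) x.
Proof. by rewrite /scalek scalerA mulr_algl scalerA. Qed.
Let scalek1 : left_id 1 scalek.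
Proof. by move=> x; rewrite /scalek !scale1r. Qed.
Let scalekDr : right_distributive scalek +%R.
Proof. by move=> a x y; rewrite /scalek scalerDr. Qed.
Let scalekDl x : {morph scalek^~ x : a b / a + b}.
Proof. by move=> a b; rewrite /scalek !scalerDl. Qed.
HB.instance Definition _ :=
  GRing.Zmodule_isLmodule.Build k (restrict M)
    scalekA scalek1 scalekDr scalekDl.

Lemma restrictZE c (x : restrict M) : c *: x = (c%:A : R) *: (x : M).
Proof. by []. Qed.
End RestrictModule.

Section RestrictMap.
Variables (M N : lmodType R) (f : {linear M -> N}).

Fact restrict_map_linear : linear (f : restrict M -> restrict N).
Proof. by move=> c x y; rewrite !restrictZE linearP. Qed.

Definition restrict_map : {linear restrict M -> restrict N} :=
  linear_map restrict_map_linear.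
End RestrictMap.

Section DualModule.
Variable M : lmodType R.

(* Hom_k(M, k), as an R-module through (r *: phi) x = phi (r *: x). *)
Definition dual : Type := Hom (restrict M) k^o.
HB.instance Definition _ := GRing.Zmodule.on dual.

Let scaleD (r : R) (phi : dual) : dual :=
  linear_comp phi (restrict_map (mulmap M r)).
Let scaleDA a b phi : scaleD a (scaleD b phi) = scaleD (a * b) phi.
Proof. by apply: linear_eqP => x /=; rewrite scalerA mulrC. Qed.
Let scaleD1 : left_id 1 scaleD.
Proof. by move=> phi; apply: linear_eqP => x /=; rewrite scale1r. Qed.
Let scaleDDr : right_distributive scaleD +%R.
Proof. by move=> a f g; apply: linear_eqP. Qed.
Let scaleDDl phi : {morph scaleD^~ phi : a b / a + b}.
Proof. by move=> a b; apply: linear_eqP => x /=; rewrite scalerDl linearD. Qed.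
HB.instance Definition _ :=
  GRing.Zmodule_isLmodule.Build R dual scaleDA scaleD1 scaleDDr scaleDDl.

Lemma dualDE (phi psi : dual) x : (phi + psi) x = phi x + psi x.
Proof. by []. Qed.
Lemma dualZE r (phi : dual) x : (r *: phi) x = phi (r *: (x : M)).
Proof. by []. Qed.
End DualModule.

Section DualMap.
Variables (M N : lmodType R) (f : {linear M -> N}).

Fact dual_map_linear :
  linear (fun phi : dual N => linear_comp phi (restrict_map f) : dual M).
Proof.
move=> r phi psi; apply: linear_eqP => x.
rewrite -[LHS]/(phi (r *: f x) + psi (f x)).
by rewrite -[RHS]/(phi (f (r *: (x : M))) + psi (f x)) linearZ.
Qed.

Definition dual_map : {linear dual N -> dual M} := linear_map dual_map_linear.
End DualMap.

Definition nakayama (M : lmodType R) : lmodType R := dual (Hom M R^o).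

Definition nakayama_map (M N : lmodType R) (f : {linear M -> N}) :
  {linear nakayama M -> nakayama N} := dual_map (hom_pre R^o f).

Lemma nakayama_map_id M x : nakayama_map (linear_id M) x = x.
Proof.
by apply: linear_eqP => g /=; congr (x _); apply: linear_eqP.
Qed.

Lemma nakayama_map_comp (L M N : lmodType R)
    (g : {linear M -> N}) (f : {linear L -> M}) x :
  nakayama_map (linear_comp g f) x = nakayama_map g (nakayama_map f x).
Proof.
by apply: linear_eqP => h /=; congr (x _); apply: linear_eqP.
Qed.
End Duality.

Record projModule (R : pzRingType) := ProjModule {
  projModule_sort :> lmodType R;
  projModule_fin : finitely_generated projModule_sort;
  projModule_proj : projective projModule_sort
}.

Record setFunctor (R : pzRingType) := SetFunctor {
  fobj :> projModule R -> Type;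
  fmap : forall M N : projModule R, {linear M -> N} -> fobj M -> fobj N;
  fmap_id : forall (M : projModule R) x, fmap (linear_id M) x = x;
  fmap_comp : forall (L M N : projModule R) (g : {linear M -> N})
    (f : {linear L -> M}) x, fmap (linear_comp g f) x = fmap g (fmap f x)
}.

Arguments fmap {R} s {M N} f x.

Record modFunctor (R : pzRingType) := ModFunctor {
  mobj :> projModule R -> lmodType R;
  mmap : forall M N : projModule R,
    {linear M -> N} -> {linear mobj M -> mobj N};
  mmap_id : forall (M : projModule R) x, mmap (linear_id M) x = x;
  mmap_comp : forall (L M N : projModule R) (g : {linear M -> N})
    (f : {linear L -> M}) x, mmap (linear_comp g f) x = mmap g (mmap f x)
}.

Arguments mmap {R} m {M N} f.

Definition forget (R : pzRingType) (F : modFunctor R) : setFunctor R :=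
  {| fobj M := F M;
     fmap M N f := mmap F f;
     fmap_id := @mmap_id R F;
     fmap_comp := @mmap_comp R F |}.

Record Nat (R : pzRingType) (F G : setFunctor R) := NatTrans {
  component :> forall M : projModule R, F M -> G M;
  natural : forall (M N : projModule R) (f : {linear M -> N}) x,
    component (fmap F f x) = fmap G f (component x)
}.

(* Pointwise R-module operations on transformations into a module-valued
   functor.  [Nat] lives in a universe above that of [lmodType R], so it cannot
   be given an [lmodType R] structure. *)
Section NatModule.
Variables (R : comNzRingType) (F : setFunctor R) (G : modFunctor R).

Fact nat_add_natural (s t : Nat F (forget G)) (M N : projModule R)
    (f : {linear M -> N}) x :
  s N (fmap F f x) + t N (fmap F f x) = mmap G f (s M x + t M x) :> G N.
Proof. by rewrite !natural linearD. Qed.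

Definition nat_add (s t : Nat F (forget G)) : Nat F (forget G) :=
  @NatTrans _ F (forget G) (fun M x => s M x + t M x : G M)
    (nat_add_natural s t).

Fact nat_scale_natural (r : R) (s : Nat F (forget G)) (M N : projModule R)
    (f : {linear M -> N}) x :
  r *: (s N (fmap F f x) : G N) = mmap G f (r *: (s M x : G M)).
Proof. by rewrite natural linearZ. Qed.

Definition nat_scale (r : R) (s : Nat F (forget G)) : Nat F (forget G) :=
  @NatTrans _ F (forget G) (fun M x => r *: (s M x : G M))
    (nat_scale_natural r s).
End NatModule.

Definition Gamma (R : comNzRingType) (I : ideal R) : setFunctor R :=
  {| fobj M := torsion I M;
     fmap M N f := torsion_map f;
     fmap_id M x := torsion_map_id x;
     fmap_comp L M N g f x := torsion_map_comp g f x |}.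

Definition Nakayama (k : fieldType) (R : comAlgType k) : modFunctor R :=
  {| mobj M := nakayama M;
     mmap M N f := nakayama_map f;
     mmap_id M x := nakayama_map_id x;
     mmap_comp L M N g f x := nakayama_map_comp g f x |}.

(* Main.v *)
From mathcomp Require Import all_boot all_algebra.
From mathcomp Require Import boolp.
Require Import Defs.

(** Projectivity of [R/I] splits [R -> R/I], so [I] is generated by an
    idempotent [1 - u], where [u] is the image of [1] under a section
    ([annihilating_unit]).  Hence every power [I^n] contains [I]
    ([sub_ideal_pow]), and evaluation at the class of [1] identifies the torsion
    functor with [M |-> (0 :_M I)], naturally in [M] ([torsion_value_inj],
    [torsion_value_map], [torsion_value_killed], [torsion_value_onto]).  This
    functor is represented by [R/I], which is the direct summand [Ru] of [R];
    the universal element is [u], and the result is the Yoneda lemma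

      Nat(Gamma_I, V) = V(R/I) = D Hom(R/I, R) = D(0 :_R I).

    The argument below inlines Yoneda at the free module [R] instead of at
    [R/I].  A transformation [t] goes to the functional
    [x |-> t_R(u)(multiplication by x)] on [(0 :_R I)], and a functional [phi]
    goes to the transformation sending a torsion element of [M] with value [m]
    to [h |-> phi (h m)] in [D Hom(M, R)].  These are mutually inverse because
    [x * u = x] for [x] in [(0 :_R I)], so that the torsion element of [R] with
    value [x] is the image of [u] under multiplication by [x]. *)

Set Implicit Arguments.
Unset Strict Implicit.
Unset Printing Implicit Defensive.

Import GRing.Theory.
Local Open Scope ring_scope.
Local Open Scope quotient_scope.

(** * Maps out of quotient modules *)

Section QuotientMaps.
Variables (R : pzRingType) (V : lmodType R) (S : submodule V).

Fact quotmod_pi_linear : linear (fun x : V => \pi_(quotmod S) x).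
Proof. by move=> a x y; rewrite pi_quotmodZ -raddfD. Qed.

Definition quotmod_pi : {linear V -> quotmod S} := linear_map quotmod_pi_linear.

Lemma quotmod_pi_eq0 x : x \in S -> \pi_(quotmod S) x = 0.
Proof.
move=> xS; rewrite -(linear0 quotmod_pi); apply/eqP.
by rewrite -Quotient.idealrBE subr0.
Qed.

Lemma quotmod_lift (M : lmodType R) (f : {linear V -> M}) :
  (forall x, x \in S -> f x = 0) ->
  exists g : {linear quotmod S -> M}, forall x, g (\pi_(quotmod S) x) = f x.
Proof.
move=> f0; pose g (x : quotmod S) := f (repr x).
have gE x : g (\pi_(quotmod S) x) = f x.
  apply/eqP; rewrite -subr_eq0 -linearB; apply/eqP/f0.
  by rewrite Quotient.idealrBE reprK.
have g_lin : linear g.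
  move=> a; elim/quotmod_ind => x; elim/quotmod_ind => y.
  by rewrite pi_quotmodZ -raddfD !gE linearP.
by exists (linear_map g_lin).
Qed.

End QuotientMaps.

(** * The free module of rank one and the idempotent of [I] *)

Section Scalars.
Variable R : comNzRingType.

Lemma free1_fg : finitely_generated R^o.
Proof.
exists 1%N, (fun=> 1) => x; exists (fun=> x).
by rewrite big_ord1 [RHS]mulr1.
Qed.

Fact act_on_linear (M : lmodType R) (m : M) : linear (fun r : R^o => r *: m).
Proof. by move=> a x y; rewrite scalerDl scalerA. Qed.

Definition act_on (M : lmodType R) (m : M) : {linear R^o -> M} :=
  linear_map (act_on_linear m).

Lemma free1_projective : projective R^o.
Proof.
move=> A B p f p_onto; have [a pa] := p_onto (f 1).
exists (act_on a) => x /=; rewrite linearZ pa -linearZ.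
by congr (f _); apply: mulr1.
Qed.

Definition free1 : projModule R := ProjModule free1_fg free1_projective.

(** The image [u] of [1] under a section of [R -> R/I]: it is killed by [I]
    because [1] is so in [R/I]. *)
Lemma annihilating_unit (I : ideal R) : projective (quotmod I) ->
  exists u : R, (forall a, a \in I -> a * u = 0) /\ 1 - u \in I.
Proof.
move=> /(_ R^o _ (quotmod_pi I) (linear_id _)) [|s sK].
  by elim/quotmod_ind => x; exists x.
exists (s (\pi_(quotmod I) (1 : R^o))); split=> [a aI|].
  have -> : a * s (\pi_(quotmod I) (1 : R^o)) = s (a *: \pi_(quotmod I) (1 : R^o)).
    by rewrite linearZ.
  rewrite pi_quotmodZ quotmod_pi_eq0 ?linear0 //.
  by have -> : a *: (1 : R^o) = a by apply: mulr1.
set v := s _; have : (1 : R^o) - v \in I.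
  by rewrite Quotient.idealrBE; apply/eqP/esym/(sK (\pi_(quotmod I) (1 : R^o))).
by [].
Qed.

Section Idempotent.
Variables (I : ideal R) (u : R).
Hypotheses (u_kills : forall a, a \in I -> a * u = 0) (u_unit : 1 - u \in I).

(** Multiplication by [1 - u], an element of [I], is the identity on [I]. *)
Lemma sub_ideal_pow n : {subset I <= ideal_pow I n}.
Proof.
elim: n => // n IHn a aI; apply/asboolP; exists [:: (1 - u, a)].
split=> [p|]; first by rewrite inE => /eqP ->; split=> //; apply: IHn.
by rewrite big_seq1 mulrBl mul1r [u * a]mulrC u_kills // subr0.
Qed.

Lemma killed_mul_unit (x : R) : (forall a, a \in I -> a * x = 0) -> x * u = x.
Proof.
by move=> /(_ _ u_unit); rewrite mulrBl mul1r mulrC => /eqP; rewrite subr_eq0 => /eqP.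
Qed.

End Idempotent.

(** * Torsion as the submodule annihilated by [I] *)

Section TorsionValue.
Variable I : ideal R.

(** The inclusion of the [I]-power torsion of [M] in [M]. *)
Definition torsion_value (M : lmodType R) (y : torsion I M) : M :=
  tagged (repr y) (\pi_(quotmod (ideal_pow I (tag (repr y)))) (1 : R^o)).

Lemma hom_quotE (M : lmodType R) (S : ideal R) (g : {linear quotmod S -> M}) x :
  g (\pi_(quotmod S) x) = x *: g (\pi_(quotmod S) (1 : R^o)).
Proof. by rewrite -linearZ pi_quotmodZ; congr (g (\pi _)); apply/esym/mulr1. Qed.

Lemma torsion_value_trans (M : lmodType R) i j (h : (i <= j)%N)
    (g : torsion_system I M i) x :
  system_map h g (\pi_(quotmod (ideal_pow I j)) x)
    = g (\pi_(quotmod (ideal_pow I i)) x).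
Proof. by congr (g _); apply: quotmod_projE. Qed.

Lemma torsion_valueE (M : lmodType R) n (g : torsion_system I M n) :
  torsion_value (to_limit g) = g (\pi_(quotmod (ideal_pow I n)) (1 : R^o)).
Proof.
have /eqP := reprK (to_limit g); rewrite [X in _ == X -> _]/to_limit.
rewrite /torsion_value; move: (repr _) => y; rewrite eqmodE.
move=> /asboolP[m [hy [hg e]]].
by rewrite -(torsion_value_trans hy) e torsion_value_trans.
Qed.

(** A map out of the cyclic module [R/I^n] is determined by its value at the
    class of [1]; two torsion elements are compared at a common index. *)
Lemma torsion_value_inj (M : lmodType R) : injective (@torsion_value M).
Proof.
elim/torsion_ind=> m f; elim/torsion_ind=> n g; rewrite !torsion_valueE => e.
apply/eqP; rewrite eqmodE; apply/asboolP.
exists (maxn m n), (leq_maxl m n), (leq_maxr m n) => /=.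
apply: linear_eqP; elim/quotmod_ind => x.
by rewrite !torsion_value_trans hom_quotE e -hom_quotE.
Qed.

Lemma torsion_value_map (M N : lmodType R) (f : {linear M -> N}) y :
  torsion_value (torsion_map f y) = f (torsion_value y).
Proof. by elim/torsion_ind: y => n g; rewrite torsion_mapE !torsion_valueE. Qed.

Lemma torsion_value_onto (M : lmodType R) (m : M) :
  (forall a, a \in I -> a *: m = 0) -> exists y, torsion_value y = m.
Proof.
move=> m0; have [x /asboolP[s [sI ->]]|g gE] :=
    @quotmod_lift _ _ (ideal_pow I 1) _ (act_on m).
  rewrite linear_sum big_seq big1 // => p /sI[pI _] /=.
  by rewrite mulrC -scalerA m0 // scaler0.
exists (to_limit (g : torsion_system I M 1)).
by rewrite torsion_valueE gE; apply: scale1r.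
Qed.

Lemma torsion_value_killed (M : lmodType R) (y : torsion I M) a :
  (forall n, {subset I <= ideal_pow I n}) -> a \in I -> a *: torsion_value y = 0.
Proof.
move=> I_sub aI; elim/torsion_ind: y => n g; rewrite torsion_valueE -hom_quotE.
by rewrite quotmod_pi_eq0 ?linear0 // I_sub.
Qed.

End TorsionValue.
End Scalars.

Lemma nat_eqP (R : pzRingType) (F G : setFunctor R) (s t : Nat F G) :
  (forall M x, s M x = t M x) -> s = t.
Proof.
case: s t => [s sN] [t tN] /= st.
have e : s = t by apply: functional_extensionality_dep => M; apply: funext.
by move: sN tN; rewrite e => sN tN; rewrite (Prop_irrelevance sN tN).
Qed.

(** * The two directions of the Yoneda correspondence *)

Section Yoneda.
Variables (k : fieldType) (R : comAlgType k) (I : ideal R).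

Lemma annihilatorP (x : R) :
  reflect (forall a, a \in I -> a * x = 0) (x \in annihilator I).
Proof. exact: asboolP. Qed.

Section ToDual.
Variables (z : torsion I R^o) (s : Nat (Gamma I) (forget (Nakayama R))).

(** The ascription displays the Set-valued component as a functional on the
    endomorphisms of [R], to be applied to multiplications. *)
Definition at_free : nakayama (R^o : lmodType R) := s (free1 R) z.

Fact to_dual_linear :
  linear (fun x : restrict (submod (annihilator I)) =>
    at_free (act_on (val x : R^o))).
Proof.
move=> c x y; rewrite -linearP; congr (at_free _).
apply: linear_eqP => r.
rewrite -[LHS]/(r * (c%:A * val x + val y)).
by rewrite -[RHS]/(c%:A * (r * val x) + r * val y) mulrDr mulrCA.
Qed.

Definition to_dual : dual (submod (annihilator I)) := linear_map to_dual_linear.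

Lemma to_dualE x : to_dual x = at_free (act_on (val x : R^o)).
Proof. by []. Qed.

End ToDual.

Section FromDual.
Hypothesis I_sub : forall n, {subset I <= ideal_pow I n}.
Variable phi : dual (submod (annihilator I)).

Section Component.
Variables (M : lmodType R) (y : torsion I M).

Fact hom_value_killed (h : Hom M R^o) : h (torsion_value y) \in annihilator I.
Proof.
apply/annihilatorP => a aI.
rewrite -[LHS]/(a *: h (torsion_value y)) -linearZ.
by rewrite torsion_value_killed // linear0.
Qed.

Let hom_value (h : Hom M R^o) : submod (annihilator I) :=
  Sub (h (torsion_value y)) (hom_value_killed h).

Fact from_dual_linear :
  linear (fun h : restrict (Hom M R^o) => phi (hom_value h)).
Proof. by move=> c g h; rewrite -linearP; congr (phi _); apply: val_inj. Qed.

Definition from_dual_at : nakayama M := linear_map from_dual_linear.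

End Component.

Fact from_dual_natural (M N : projModule R) (f : {linear M -> N})
    (y : torsion I M) :
  from_dual_at (torsion_map f y) = nakayama_map f (from_dual_at y).
Proof.
apply: linear_eqP => h; congr (phi _); apply: val_inj => /=.
by rewrite torsion_value_map.
Qed.

Definition from_dual : Nat (Gamma I) (forget (Nakayama R)) :=
  @NatTrans _ (Gamma I) (forget (Nakayama R)) (fun M => @from_dual_at M)
    from_dual_natural.

Lemma from_dualE (M : projModule R) (y : torsion I M) (h : Hom M R^o) x :
  h (torsion_value y) = val x -> (from_dual M y : nakayama M) h = phi x.
Proof. by move=> e; congr (phi _); apply: val_inj. Qed.

End FromDual.

End Yoneda.

Theorem proposition5p7 (k : fieldType) (R : comAlgType k) (I : ideal R)
    (R_findim : finitely_generated (R : lmodType k))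
    (R_reduced : reduced I R^o)
    (RI_proj : projective (quotmod I)) :
  exists Phi : Nat (Gamma I) (forget (Nakayama R)) ->
               dual (submod (annihilator I)),
    [/\ bijective Phi,
        forall s t, Phi (nat_add s t) = Phi s + Phi t
      & forall (r : R) s, Phi (nat_scale r s) = r *: Phi s].
Proof.
have [u [u_kills u_unit]] := annihilating_unit RI_proj.
have I_sub := sub_ideal_pow u_kills u_unit.
have [z zE] := torsion_value_onto (M := R^o) u_kills.
exists (to_dual z); split=> [|s t|r s].
- exists (from_dual I_sub) => [s|phi].
    apply: nat_eqP => M y; apply: linear_eqP => h.
    pose m : R^o := h (torsion_value y).
    (* The Yoneda step: both sides are [s] at the torsion element of [R] with
       value [m], read at the identity. *)
    have zm : torsion_map (act_on m) z = torsion_map h y.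
      apply: torsion_value_inj; rewrite !torsion_value_map zE -[LHS]/(u * m) mulrC.
      apply: (killed_mul_unit u_unit).
      by apply/annihilatorP/hom_value_killed.
    have sm : nakayama_map (act_on m) (at_free z s) = nakayama_map h (s M y).
      have e1 := natural s (M := free1 R) (N := free1 R) (act_on m) z.
      have e2 := natural s (N := free1 R) h y.
      exact: etrans (esym e1) (etrans (congr1 (s (free1 R)) zm) e2).
    have := congr1 (fun w : nakayama (R^o : lmodType R) => w (linear_id R^o)) sm.
    rewrite -[X in X = _]/(at_free z s (linear_comp (linear_id _) (act_on m))).
    rewrite -[X in _ = X]/((s M y : nakayama M) (linear_comp (linear_id _) h)).
    have -> : linear_comp (linear_id _) (act_on m) = act_on m by apply: linear_eqP.
    by have -> : linear_comp (linear_id _) h = h by apply: linear_eqP.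
  apply: linear_eqP => x; apply: from_dualE.
  rewrite zE -[LHS]/(u * val x) mulrC; apply: (killed_mul_unit u_unit).
  exact/annihilatorP/(valP x).
- exact: linear_eqP.
- apply: linear_eqP => x; rewrite dualZE !to_dualE.
  rewrite -[LHS]/(at_free z s (r *: (act_on (val x : R^o) : Hom R^o R^o))).
  congr (at_free z s _); apply: linear_eqP => a.
  by rewrite -[RHS]/(a * (r * val x)) mulrCA.
Qed.
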